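(* Let $T\ge 1$. Then for all integers $N\ge1$, all $\Delta t>0$ with $N\Delta t\le T$, and all $n\in\mathbb{Z}$, the Fourier-mode vectors $\bm{\sigma}^n,\bm{f}^n\in\mathbb{C}^{N+1}$ of the forward Euler scheme on the unit circle (defined in the context) satisfy $$\|\bm{\sigma}^n\|\;\le\;10\,T\,\|\bm{f}^n\| .$$ That is, when the boundary is the unit circle $S^1$, the forward Euler scheme for the double-layer second-kind Volterra integral equation of the Dirichlet problem for the heat equation is unconditionally stable on any finite time interval $[0,T]$.
   Context: Let $\Gamma=S^1\subset\mathbb{R}^2$ be the unit circle. The double layer heat kernel on $\Gamma$ is $$K(\mathbf{x},\mathbf{y},t)=-\frac{1-\mathbf{x}\cdot\mathbf{y}}{8\pi t^2}\,e^{-\frac{1-\mathbf{x}\cdot\mathbf{y}}{2t}},\qquad t>0 .$$ Given data $f_0,\dots,f_N\in L^2(\Gamma)$ with $f_0\equiv0$, the forward Euler scheme determines $\sigma_0\equiv 0,\sigma_1,\dots,\sigma_N$ by $$-\tfrac12\sigma_j(\mathbf{x})+\sum_{k=0}^{j-1}\int_{k\Delta t}^{(k+1)\Delta t}\int_\Gamma K(\mathbf{x},\mathbf{y},j\Delta t-\tau)\,\sigma_k(\mathbf{y})\,ds(\mathbf{y})\,d\tau=f_j(\mathbf{x}),\qquad j=0,1,\dots,N .$$ Write $\sigma_j=\sum_{n\in\mathbb{Z}}\sigma_j^n e^{in\theta}$, $f_j=\sum_{n\in\mathbb{Z}}f_j^n e^{in\theta}$ in the polar angle $\theta$, and $\bm{\sigma}^n=\{\sigma_j^n\}_{j=0}^N$,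 $\bm{f}^n=\{f_j^n\}_{j=0}^N$. In Fourier modes the scheme reads $(-\tfrac12 I-V^n)\bm{\sigma}^n=\bm{f}^n$, where $V^n\in\mathbb{R}^{(N+1)\times(N+1)}$ has entries $V^n_{jk}=v^n_{j-k}$ for $j>k$ and $0$ otherwise, with $$v^n_l=\int_0^{\Delta t}\gamma_n(l\Delta t-\tau)\,d\tau\ (l\ge1),\qquad \gamma_n(t)=\frac{1}{8\pi t^2}\int_0^{2\pi}(1-\cos s)\,e^{-\frac{1-\cos s}{2t}}\cos(ns)\,ds .$$ $\|\cdot\|$ is the $\ell^2$-norm on $\mathbb{C}^{N+1}$. *)

(* Defs.v *)
From HB Require Import structures.
From mathcomp Require Import all_boot all_order all_algebra.
From mathcomp Require Import all_classical all_reals all_analysis.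
From mathcomp Require Export complex.

Set Implicit Arguments.
Unset Strict Implicit.
Unset Printing Implicit Defensive.

Import Order.TTheory GRing.Theory Num.Theory.

Local Open Scope classical_set_scope.
Local Open Scope ring_scope.
Local Open Scope complex_scope.

Definition dot2 (R : realType) (x y : R * R) : R := x.1 * y.1 + x.2 * y.2.

Definition circle_pt (R : realType) (theta : R) : R * R := (cos theta, sin theta).

Definition angles (R : realType) : set R := `[0, 2 * pi].

(* Functions on the unit circle are represented by functions on the plane, of
   which only the values at the points [circle_pt theta] are ever used.
   Since [circle_pt] has unit speed, arc length is Lebesgue measure in the
   polar angle. *)

Definition cintegral (R : realType) (D : set R) (g : R -> R[i]) : R[i] :=
  (\int[lebesgue_measure]_(x in D) complex.Re (g x)) +i*
  (\int[lebesgue_measure]_(x in D) complex.Im (g x)).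

Definition circle_integral (R : realType) (g : R * R -> R[i]) : R[i] :=
  cintegral (@angles R) (fun theta => g (circle_pt theta)).

Definition circle_ae_eq (R : realType) (g h : R * R -> R[i]) : Prop :=
  {ae @lebesgue_measure R, forall theta, angles theta ->
     g (circle_pt theta) = h (circle_pt theta)}.

Definition circle_L2 (R : realType) (g : R * R -> R[i]) : Prop :=
  [/\ measurable_fun (@angles R) (fun theta => complex.Re (g (circle_pt theta))),
      measurable_fun (@angles R) (fun theta => complex.Im (g (circle_pt theta))) &
      (@lebesgue_measure R).-integrable (@angles R)
        (fun theta => (ComplexField.Normc.normc (g (circle_pt theta)) ^+ 2)%:E)].

(* n-th coefficient of the expansion g = \sum_n g^n e^{i n theta}:
   (2 pi)^-1 times the integral of g e^{- i n theta}. *)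
Definition fourier_coef (R : realType) (g : R * R -> R[i]) (n : int) : R[i] :=
  ((2 * pi)^-1)%:C *
  cintegral (@angles R) (fun theta =>
    g (circle_pt theta) * (cos (n%:~R * theta) -i* sin (n%:~R * theta))).

(* Double layer heat kernel, meaningful for x and y on the unit circle, 0 < t. *)
Definition double_layer_kernel (R : realType) (x y : R * R) (t : R) : R :=
  - ((1 - dot2 x y) / (8 * pi * t ^+ 2)) * expR (- ((1 - dot2 x y) / (2 * t))).

Definition euler_lhs (R : realType) (N : nat) (dt : R)
    (sigma : 'I_N.+1 -> R * R -> R[i]) (j : 'I_N.+1) (x : R * R) : R[i] :=
  (- 2^-1)%:C * sigma j x +
  \sum_(k < N.+1 | (k < j)%N)
    cintegral `[k%:R * dt, k.+1%:R * dt] (fun tau =>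
      circle_integral (fun y =>
        (double_layer_kernel x y (j%:R * dt - tau))%:C * sigma k y)).

(* The equations hold in L^2, i.e., almost everywhere; the one for j = 0
   reads - sigma 0 / 2 = f 0 = 0. *)
Definition forward_euler (R : realType) (N : nat) (dt : R)
    (f sigma : 'I_N.+1 -> R * R -> R[i]) : Prop :=
  [/\ forall j, circle_L2 (f j),
      circle_ae_eq (f ord0) (fun=> 0),
      forall j, circle_L2 (sigma j) &
      forall j, circle_ae_eq (euler_lhs dt sigma j) (f j)].

Definition fourier_mode (R : realType) (N : nat)
    (g : 'I_N.+1 -> R * R -> R[i]) (n : int) : 'cV[R[i]]_N.+1 :=
  \col_j fourier_coef (g j) n.

Definition l2norm (R : realType) (m : nat) (v : 'cV[R[i]]_m) : R :=
  Num.sqrt (\sum_(j < m) ComplexField.Normc.normc (v j 0) ^+ 2).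

(* Main.v *)
Require Import Defs.
From mathcomp Require Import all_boot all_order all_algebra.
From mathcomp Require Import all_classical all_reals all_analysis measurable_realfun.
From mathcomp Require Import ring lra zify.

Set Implicit Arguments.
Unset Strict Implicit.
Unset Printing Implicit Defensive.

Import Order.TTheory GRing.Theory Num.Theory.
Import numFieldNormedType.Exports.

Local Open Scope classical_set_scope.
Local Open Scope ring_scope.
Local Open Scope complex_scope.

(** Up to the factor -1/(4 pi), the kernel is the time derivative of
    exp(-a/(2t)) with a = 1 - cos(x - y). So the time integral over a step turns
    it into a nonnegative, even, periodic convolution kernel g_l in the angle,
    and by Fubini the n-th Fourier mode of the scheme is a discrete Volterra
    equation whose weights are bounded by the masses of the g_l. These masses
    telescope: their sum is at most (4 pi)^-1 times the integral of
    exp(-(1 - cos s)/(2T)), hence at most 1/2 - 1/(8T). Young's inequality for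
    the discrete convolution then bounds ||sigma|| by 8T ||f||. *)

(** The margin is thin. The diagonal coefficient of the scheme has modulus 1/2, and over an
    unbounded time horizon the masses of the g_l add up to exactly 1/2, namely (4 pi)^-1 times the
    length 2 pi, so that mode 0 would keep no coercivity. The finite horizon supplies it: the
    deficit 1/(8T) is the coercivity constant, and its inverse is the stability constant. The other
    modes are no worse, because the g_l are nonnegative. The analytic obstacle is the singularity of
    the kernel at t = 0. It is met in the most recent step, [k.+1 = j], where the kernel is not
    bounded jointly in time and angle. Integrating in time first removes it, since the primitive
    exp(-a/(2t)) stays between 0 and 1; this also gives the absolute integrability that Fubini
    requires. Complex data are split into real and imaginary parts, each tested against cos and sin.
    As the convolution kernel is real and even, convolution multiplies either test integral by one
    and the same real number. *)

(** * Translation, reflection and periodicity of Lebesgue integrals *)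

(** For nonnegative functions this is integration against a pushforward measure. Positive and
    negative parts are then compared separately, so that integrability never enters. *)
Lemma integral_preserving (R : realType) (phi : R -> R) (D : set R)
    (f : R -> \bar R) :
  measurable_fun setT phi ->
  (forall A, measurable A ->
     lebesgue_measure (phi @^-1` A) = lebesgue_measure A :> \bar R) ->
  measurable D -> measurable_fun [set: R] f ->
  (\int[lebesgue_measure]_(x in D) f x =
   \int[lebesgue_measure]_(x in phi @^-1` D) f (phi x))%E.
Proof.
move=> mphi phiP mD mf.
have aux (g : R -> \bar R) : measurable_fun [set: R] g -> (forall x, 0 <= g x)%E ->
    (\int[lebesgue_measure]_(x in D) g x =
     \int[lebesgue_measure]_(x in phi @^-1` D) g (phi x))%E.
  move=> mg g0.
  rewrite -(@ge0_integral_pushforward _ _ _ _ _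
    (phi : measurableTypeR R -> measurableTypeR R) mphi lebesgue_measure D g)//.
    by apply: eq_measure_integral => //= A mA _; rewrite /pushforward phiP.
  exact: measurable_funTS.
rewrite integralE [RHS]integralE.
congr (_ - _)%E.
  rewrite (aux _ (measurable_funepos mf)) => [|x]; last exact: funepos_ge0.
  by apply: eq_integral => x _; by rewrite unlock.
rewrite (aux _ (measurable_funeneg mf)) => [|x]; last exact: funeneg_ge0.
by apply: eq_integral => x _; by rewrite unlock.
Qed.

(** The pushforward under a translation gives every half-open interval its length, and Lebesgue
    measure is the only measure that does so. *)
Lemma lebesgue_measure_shift (R : realType) (c : R) (A : set R) :
  measurable A ->
  lebesgue_measure ((fun x => x + c) @^-1` A) = lebesgue_measure A :> \bar R.
Proof.
move=> mA; have mphi : measurable_fun setT (fun x : R => x + c).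
  by apply: continuous_measurable_fun => x; apply: cvgD => //; exact: cvg_cst.
apply/esym.
have := @lebesgue_measure_unique R (pushforward lebesgue_measure
  (fun x : measurableTypeR R => (x + c : measurableTypeR R))).
apply => //= _ [[a b]] _ <-.
rewrite /pushforward (_ : _ @^-1` _ = `](a - c), (b - c)]%classic); last first.
  by apply/seteqP; split => x /=; rewrite !in_itv/= => /andP[]; lra.
rewrite /= !lebesgue_measure_itv/= !lte_fin ltrD2r.
by case: ifP => // _; rewrite -!EFinB; congr (_%:E); ring.
Qed.

Lemma lebesgue_measure_reflect (R : realType) (c : R) (A : set R) :
  measurable A ->
  lebesgue_measure ((fun x => c - x) @^-1` A) = lebesgue_measure A :> \bar R.
Proof.
move=> mA.
rewrite (_ : _ @^-1` _ = -%R @^-1` ((fun x => x + c) @^-1` A)); last first.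
  by apply/seteqP; split => x /=; rewrite addrC.
rewrite -[RHS](lebesgue_measure_shift c)//.
apply: lebesgue_measureN.
rewrite -[X in measurable X]setTI; suff : measurable_fun setT (fun x : R => x + c).
  by apply.
by apply: continuous_measurable_fun => x; apply: cvgD => //; exact: cvg_cst.
Qed.

Lemma Rintegral_shift (R : realType) (c : R) (D : set R) (f : R -> R) :
  measurable D -> measurable_fun setT f ->
  \int[lebesgue_measure]_(x in D) f x =
  \int[lebesgue_measure]_(x in (fun x => x + c) @^-1` D) f (x + c).
Proof.
move=> mD mf; congr fine.
apply: (@integral_preserving R (fun x => x + c)) => //; last 2 first.
- exact: lebesgue_measure_shift.
- exact/measurable_EFinP.
by apply: continuous_measurable_fun => x; apply: cvgD => //; exact: cvg_cst.
Qed.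

Lemma integral_reflect (R : realType) (c a b : R) (f : R -> \bar R) :
  measurable_fun setT f ->
  (\int[lebesgue_measure]_(x in `[a, b]) f (c - x)%R =
   \int[lebesgue_measure]_(x in `[(c - b)%R, (c - a)%R]) f x)%E.
Proof.
move=> mf; rewrite (@integral_preserving R (fun x => c - x) _ f)//; last 2 first.
- by apply: continuous_measurable_fun => x; apply: cvgB => //; exact: cvg_cst.
- exact: lebesgue_measure_reflect.
rewrite (_ : _ @^-1` _ = `[a, b]%classic)//.
by apply/seteqP; split => x /=; rewrite !in_itv/= => /andP[]; lra.
Qed.

Lemma bounded_integrable (R : realType) (A : set R) (f : R -> R) (M : R) :
  measurable A -> (lebesgue_measure A < +oo)%E -> measurable_fun A f ->
  (forall x, A x -> `|f x| <= M) ->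
  (@lebesgue_measure R).-integrable A (EFin \o f).
Proof.
move=> mA Aoo mf fM; apply: measurable_bounded_integrable => //.
exists M; split; first exact: num_real.
by move=> x Mx y Ay; apply: le_trans (fM _ Ay) (ltW Mx).
Qed.

Lemma lebesgue_measure_itvcc_lty (R : realType) (a b : R) :
  (lebesgue_measure `[a, b]%classic < +oo :> \bar R)%E.
Proof. by rewrite lebesgue_measure_itv/=; case: ifP => _; rewrite ?ltry. Qed.

(** The left integral is cut at [c], the right one at [P - c]. The piece over [c, P] is translated
    by [c]; the piece over [0, c) moves to [P - c, P) at the price of one period. The range of [c]
    suffices because the shifts to come are angles in [0, 2 pi]. *)
Lemma Rintegral_periodic (R : realType) (P c : R) (f : R -> R) (M : R) :
  measurable_fun setT f -> (forall x, `|f x| <= M) ->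
  (forall x, f (x + P) = f x) -> 0 <= c <= P ->
  \int[lebesgue_measure]_(x in `[0, P]) f (x - c) =
  \int[lebesgue_measure]_(x in `[0, P]) f x.
Proof.
move=> mf fM fP /andP[c0 cP].
have mfc (d : R) : measurable_fun setT (fun x : R => f (x + d)).
  apply: measurableT_comp => //.
  by apply: continuous_measurable_fun => x; apply: cvgD => //; exact: cvg_cst.
have int (d : R) : (@lebesgue_measure R).-integrable `[0, P]
    (EFin \o (fun x => f (x + d))).
  apply: (@bounded_integrable _ _ _ M) => //.
  - exact: lebesgue_measure_itvcc_lty.
  - exact: measurable_funTS.
have int0 : (@lebesgue_measure R).-integrable `[0, P] (EFin \o f).
  have := int 0; rewrite (_ : (fun x => f (x + 0)) = f)//.
  by apply/funext => x; rewrite addr0.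
have split0 (e : R) (u : R -> R) : 0 <= e <= P ->
    (@lebesgue_measure R).-integrable `[0, P] (EFin \o u) ->
    \int[lebesgue_measure]_(x in `[0, P]) u x =
    \int[lebesgue_measure]_(x in `[0, e[) u x +
    \int[lebesgue_measure]_(x in `[e, P]) u x.
  move=> /andP[e0 eP] iu.
  have E : `[0, P]%classic = `[0, e[%classic `|` `[e, P]%classic.
    apply/seteqP; split => x /=; rewrite !in_itv/=.
      by move=> /andP[-> ->]; case: (ltP x e) => _; [left|right].
    by case=> /andP[]; lra.
  rewrite E Rintegral_setU -?E//.
  by apply/disj_setPS => x /= []; rewrite !in_itv/= => /andP[_ ?] /andP[]; lra.
rewrite (split0 c (fun x => f (x - c))) ?c0//.
rewrite (split0 (P - c) f)//; last by apply/andP; split; lra.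
rewrite addrC; congr (_ + _).
  have i0 : (@lebesgue_measure R).-integrable `[0, P - c[ (EFin \o f).
    apply: integrableS int0 => // x /=; rewrite !in_itv/= => /andP[? ?].
    by apply/andP; split; lra.
  rewrite (Rintegral_itv_bndo_bndc i0).
  rewrite (@Rintegral_shift _ (- c) `[0, P - c]%classic f)//.
  congr (Rintegral _ _ _).
  by apply/seteqP; split => x /=; rewrite !in_itv/= => /andP[]; lra.
have iP : (@lebesgue_measure R).-integrable `[P - c, P] (EFin \o f).
  apply: integrableS int0 => // x /=; rewrite !in_itv/= => /andP[? ?].
  by apply/andP; split; lra.
have iPo : (@lebesgue_measure R).-integrable `[P - c, P[ (EFin \o f).
  by apply: integrableS iP => // x /=; rewrite !in_itv/= => /andP[-> /ltW ->].
rewrite -Rintegral_itv_bndo_bndc//.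
rewrite (@Rintegral_shift _ (P - c) `[P - c, P[%classic f)//.
rewrite (_ : _ @^-1` _ = `[0, c[%classic); last first.
  by apply/seteqP; split => x /=; rewrite !in_itv/= => /andP[]; lra.
by apply: eq_Rintegral => x _; rewrite -fP; congr f; ring.
Qed.

(** * Time integration of the kernel down to the singular time 0 *)

(* The opposite of the double layer kernel, in the variable a = 1 - x.y; at
   t = 0 division makes it 0, which is also its limit from the right. *)
Definition heat_flux (R : realType) (a t : R) : R :=
  a / (8 * pi * t ^+ 2) * expR (- (a / (2 * t))).

(* The value at t = 0 is the limit of exp(-a/(2t)) from the right. *)
Definition heat_exp (R : realType) (a t : R) : R :=
  if t == 0 then (a == 0)%:R else expR (- (a / (2 * t))).

Lemma heat_flux_ge0 (R : realType) (a t : R) : 0 <= a -> 0 <= heat_flux a t.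
Proof.
move=> a0; rewrite mulr_ge0 ?expR_ge0// divr_ge0// mulr_ge0 ?sqr_ge0//.
by rewrite mulr_ge0 ?pi_ge0.
Qed.

Lemma heat_exp_ge0 (R : realType) (a t : R) : 0 <= heat_exp a t.
Proof. by rewrite /heat_exp; case: ifP => _; rewrite ?ler0n ?expR_ge0. Qed.

Lemma heat_exp_le1 (R : realType) (a t : R) :
  0 <= a -> 0 <= t -> heat_exp a t <= 1.
Proof.
move=> a0 t0; rewrite /heat_exp; case: ifP => _; first by case: eqP.
by rewrite expR_le1 oppr_le0 divr_ge0// mulr_ge0.
Qed.

Lemma heat_exp_is_derive (R : realType) (a t : R) : 0 < t ->
  is_derive t 1 (heat_exp a) (a / (2 * t ^+ 2) * expR (- (a / (2 * t)))).
Proof.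
move=> t0; have t20 : 2 * t != 0 by rewrite mulf_neq0 ?gt_eqF.
have nE : \near t, expR (- (a / (2 * t))) = heat_exp a t.
  near=> s; rewrite /heat_exp gt_eqF//.
  by near: s; exact: lt_nbhsr.
apply: (near_eq_is_derive nE).
have D1 := is_deriveV t20 (is_deriveZ 2 (is_derive_id t (1 : R))).
have D2 := is_deriveN (is_deriveZ a D1).
apply: is_derive_eq (is_derive1_comp (is_derive_expR _) D2) _.
rewrite /GRing.scale/= mulr1 mulrC; congr (_ * _).
by field; rewrite gt_eqF.
Unshelve. all: by end_near. Qed.

Lemma heat_exp_cvg0 (R : realType) (a : R) : 0 <= a ->
  heat_exp a t @[t --> 0^'+] --> heat_exp a 0.
Proof.
rewrite le_eqVlt => /predU1P[<-|a0].
  rewrite (_ : heat_exp 0 = fun=> 1); first exact: cvg_cst.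
  apply/funext => t; rewrite /heat_exp eqxx; case: ifP => // _.
  by rewrite mul0r oppr0 expR0.
rewrite {2}/heat_exp eqxx gt_eqF//.
(* With u = a/(2t), exp u >= 1 + u >= u gives exp(-u) <= 1/u = 2t/a. *)
apply: (@squeeze_cvgr _ _ _ _ (fun=> 0) (fun t => 2 / a * t)).
- near=> t; have t0 : 0 < t by near: t; exact: nbhs_right_gt.
  rewrite heat_exp_ge0/= /heat_exp gt_eqF// expRN.
  rewrite (_ : 2 / a * t = (a / (2 * t))^-1); last by field; rewrite !gt_eqF.
  rewrite lef_pV2 ?posrE ?expR_gt0// ?divr_gt0 ?mulr_gt0//.
  by apply: le_trans (expR_ge1Dx _); lra.
- exact: cvg_cst.
- apply: cvg_at_right_filter; rewrite -[X in _ --> X](mulr0 (2 / a)).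
  by apply: cvgMr; exact: cvg_id.
Unshelve. all: by end_near. Qed.

Lemma heat_flux_cvg0 (R : realType) (a : R) : 0 <= a ->
  heat_flux a t @[t --> 0^'+] --> heat_flux a 0.
Proof.
rewrite le_eqVlt => /predU1P[<-|a0].
  rewrite (_ : heat_flux 0 = fun=> 0); first exact: cvg_cst.
  by apply/funext => t; rewrite /heat_flux !mul0r.
rewrite {2}/heat_flux expr0n/= mulr0 invr0 mulr0 mul0r.
(* To beat the factor t^-2, the cubic term of the exponential is used: with u = a/(2t), exp u >=
   u^3/6, hence exp(-u) <= 48 t^3/a^3, and one power of t is left over. *)
pose C : R := a / (8 * pi) * 48 / a ^+ 3.
apply: (@squeeze_cvgr _ _ _ _ (fun=> 0) (fun t => C * t)).
- near=> t; have t0 : 0 < t by near: t; exact: nbhs_right_gt.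
  rewrite heat_flux_ge0 ?(ltW a0)//=.
  rewrite (_ : C * t = a / (8 * pi * t ^+ 2) * (48 * t ^+ 3 / a ^+ 3)); last first.
    rewrite /C; move: (@pi_gt0 R); move: (pi) => P P0.
    by field; rewrite (gt_eqF t0) (gt_eqF a0) (gt_eqF P0).
  apply: ler_wpM2l.
    by rewrite divr_ge0 ?(ltW a0)// mulr_ge0 ?sqr_ge0// mulr_ge0 ?pi_ge0.
  rewrite expRN.
  rewrite (_ : 48 * t ^+ 3 / a ^+ 3 = ((a / (2 * t)) ^+ 3 / 6)^-1); last first.
    by field; rewrite ?(gt_eqF t0) ?(gt_eqF a0).
  rewrite lef_pV2 ?posrE ?expR_gt0//; last first.
    by rewrite divr_gt0// exprn_gt0// divr_gt0// mulr_gt0.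
  have := @expR_ge1Dxn R (a / (2 * t)) 2.
  rewrite divr_ge0 ?(ltW a0)//; last by rewrite mulr_ge0 ?(ltW t0).
  by move=> /(_ isT); apply: le_trans; rewrite (_ : 3`!%N = 6%N)// lerDr.
- exact: cvg_cst.
- apply: cvg_at_right_filter; rewrite -[X in _ --> X](mulr0 C).
  by apply: cvgMr; exact: cvg_id.
Unshelve. all: by end_near. Qed.

Lemma heat_flux_continuous (R : realType) (a t : R) :
  0 < t -> {for t, continuous (heat_flux a)}.
Proof.
move=> t0; apply: cvgM.
  apply: cvgMr; apply: cvgV; first by rewrite !mulf_neq0 ?gt_eqF ?pi_gt0.
  by apply: cvgMr; exact: exprn_continuous.
apply: (cvg_comp _ (@expR R)); last exact: continuous_expR.
apply: cvgN; apply: cvgMr; apply: cvgV; first by rewrite mulf_neq0 ?gt_eqF.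
by apply: cvgMr; exact: cvg_id.
Qed.

(** The fundamental theorem of calculus with primitive [heat_exp a] divided by 4 pi. The case
    [p = 0] is the most recent time step of the scheme; there the two limits from the right give the
    continuity at the endpoint. *)
Lemma integral_heat_flux (R : realType) (a p q : R) :
  0 <= a -> 0 <= p -> p < q ->
  (\int[lebesgue_measure]_(t in `[p, q]) (heat_flux a t)%:E =
   ((heat_exp a q - heat_exp a p) / (4 * pi))%:E)%E.
Proof.
move=> a0 p0 pq; have pi0 := @pi_gt0 R.
have itv t : t \in `]p, q[ -> 0 < t.
  by rewrite in_itv/= => /andP[pt _]; exact: le_lt_trans pt.
have q0 : 0 < q by exact: le_lt_trans pq.
have D (t : R) : 0 < t -> is_derive t 1 ((4 * pi)^-1 \*: heat_exp a) (heat_flux a t).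
  move=> t0; apply: is_derive_eq (is_deriveZ (4 * pi)^-1 (heat_exp_is_derive a t0)) _.
  rewrite /GRing.scale/= mulrA; congr (_ * _).
  by move: pi pi0 => P P0; field; rewrite (gt_eqF t0) (gt_eqF P0).
rewrite (@continuous_FTC2 _ _ ((4 * pi)^-1 \*: heat_exp a))//.
- by rewrite -EFinB; congr (_%:E); rewrite /= /GRing.scale/=; move: (pi) => P; ring.
- apply/continuous_within_itvP => //; split.
  + by move=> t /itv t0; exact: heat_flux_continuous.
  + move: p0; rewrite le_eqVlt => /predU1P[<-|p0]; first exact: heat_flux_cvg0.
    by apply: cvg_at_right_filter; exact: heat_flux_continuous.
  + by apply: cvg_at_left_filter; exact: heat_flux_continuous.
- have cH (t : R) : 0 < t -> {for t, continuous ((4 * pi)^-1 \*: heat_exp a)}.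
    move=> /D[d _].
    exact/differentiable_continuous/derivable1_diffP.
  split.
  + by move=> t /itv /D[].
  + move: p0; rewrite le_eqVlt => /predU1P[<-|p0].
      by apply: cvgZr; exact: heat_exp_cvg0.
    by apply: cvg_at_right_filter; exact: cH.
  + by apply: cvg_at_left_filter; exact: cH.
- by move=> t /itv /D[_]; rewrite derive1E.
Qed.

(** The increment is 4 pi times the integral of a nonnegative flux, which covers the time 0 along
    with the others. *)
Lemma heat_exp_mono (R : realType) (a p q : R) :
  0 <= a -> 0 <= p -> p <= q -> heat_exp a p <= heat_exp a q.
Proof.
move=> a0 p0; rewrite le_eqVlt => /predU1P[->//|pq].
have : (0 <= ((heat_exp a q - heat_exp a p) / (4 * pi))%:E)%E.
  rewrite -integral_heat_flux//; apply: integral_ge0 => t _.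
  by rewrite lee_fin heat_flux_ge0.
by rewrite lee_fin pmulr_lge0 ?subr_ge0// invr_gt0 mulr_gt0 ?pi_gt0.
Qed.

(** * Exchange of integrals for a kernel singular in one variable *)

(** The hypotheses fit a kernel that is unbounded as a function of both variables. The bound [C] on
    the integrals in x, uniform in y, gives integrability on the product by Tonelli. The bound in y,
    which may depend on x, makes the inner integral finite at every x of [A], so that real and
    extended integrals agree pointwise there. *)
Lemma Rintegral_exchange (d1 d2 : measure_display) (T1 : measurableType d1)
    (T2 : measurableType d2) (R : realType)
    (m1 : {sigma_finite_measure set T1 -> \bar R})
    (m2 : {sigma_finite_measure set T2 -> \bar R})
    (A : set T1) (B : set T2) (k : T1 * T2 -> R) (h : T2 -> R) (C : R) :
  measurable A -> measurable B -> measurable_fun setT k ->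
  m2.-integrable B (EFin \o h) ->
  (forall y, B y -> \int[m1]_(x in A) (`|k (x, y)|)%:E <= C%:E)%E ->
  (forall x, A x -> exists M, forall y, B y -> `|k (x, y)| <= M) ->
  m1.-integrable A (fun x => (\int[m2]_(y in B) (k (x, y) * h y))%:E) /\
  \int[m1]_(x in A) (\int[m2]_(y in B) (k (x, y) * h y)) =
  \int[m2]_(y in B) ((\int[m1]_(x in A) k (x, y)) * h y).
Proof.
move=> mA mB mk ih kC kM.
have mh : measurable_fun setT (h \_ B).
  apply/measurable_restrict => //; rewrite setTI.
  by apply/measurable_EFinP; exact: measurable_int ih.
have mkx x : measurable_fun setT (fun y => k (x, y)).
  exact: (measurableT_comp mk (pair1_measurable x)).
have mky y : measurable_fun setT (fun x => k (x, y)).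
  exact: (measurableT_comp mk (pair2_measurable y)).
have mhB : measurable_fun B h by exact/measurable_EFinP/(measurable_int _ ih).
(* Extension by zero off [A] and [B] turns both iterated integrals into integrals over the whole
   product. *)
pose F (z : T1 * T2) : \bar R := (\1_A z.1 * k z * (h \_ B) z.2)%:E.
have mF : measurable_fun setT F.
  apply/measurable_EFinP; apply: measurable_funM; last first.
    exact: (measurableT_comp mh measurable_snd).
  apply: measurable_funM => //.
  by apply: (measurableT_comp _ measurable_fst); exact: measurable_indic.
have FA x : A x -> (\int[m2]_y F (x, y) = \int[m2]_(y in B) (k (x, y) * h y)%:E)%E.
  move=> Ax; rewrite [RHS]integral_mkcond; apply: eq_integral => y _.
  rewrite /F /= indicE mem_set// mul1r !patchE.
  by case: ifP => // _; rewrite mulr0.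
have iFx x : A x -> m2.-integrable B (fun y => (k (x, y) * h y)%:E).
  move=> Ax; have [M kxM] := kM _ Ax.
  have := @integrableMr _ _ _ m2 B mB (fun y => k (x, y)) (EFin \o h).
  apply => //; first exact: measurable_funTS.
  exists M; split; first exact: num_real.
  by move=> r Mr y By; apply: le_trans (kxM _ By) (ltW Mr).
have iky y : B y -> m1.-integrable A (fun x => (k (x, y))%:E).
  move=> By; apply/integrableP; split.
    by apply/measurable_EFinP; exact: measurable_funTS.
  by apply: le_lt_trans (kC _ By) _; rewrite ltry.
have iF : (m1 \x m2)%E.-integrable setT F.
  apply/integrable21ltyP => //.
  apply: (@le_lt_trans _ _ (\int[m2]_(y in B) (C%:E * `|(h y)%:E|))%E); last first.
    rewrite integralZl//; last exact: integrable_abse.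
    by rewrite -(fineK (integrable_fin_num mB (integrable_abse ih))) -EFinM ltry.
  rewrite [leRHS]integral_mkcond; apply: ge0_le_integral => //.
  - by move=> y _; exact: integral_ge0.
  - exact: (@measurable_fun_fubini_tonelli_G _ _ _ _ R m1 _
      (measurableT_comp (@abse_measurable R setT) mF) (fun z => abse_ge0 (F z))).
  - apply/measurable_restrict => //; rewrite setTI.
    by apply: measurable_funeM; apply: measurableT_comp => //; exact/measurable_EFinP.
  move=> y _; rewrite patchE; case: ifPn => [/set_mem By|yB].
    rewrite (_ : (fun x => `|F (x, y)|)%E =
      (fun x => `|k (x, y)|%:E * `|(h y)%:E|)%E \_ A); last first.
      apply/funext => x; rewrite /F /= !patchE mem_set//= indicE.
      by case: (_ \in _); rewrite /= ?mul1r ?mul0r ?normr0// normrM.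
    rewrite -integral_mkcond ge0_integralZr//; first exact: lee_wpmul2r (kC _ By).
    by apply/measurable_EFinP; apply: measurableT_comp => //; exact: measurable_funTS.
  rewrite integral0_eq// => x _.
  by rewrite /F /= patchE (negbTE yB) mulr0 normr0.
have EL x : A x -> (\int[m2]_(y in B) (k (x, y) * h y))%R%:E = (\int[m2]_y F (x, y))%E.
  move=> Ax; rewrite FA// fineK//; apply: integrable_fin_num => //.
  exact: iFx.
split.
  have := integrable_fubini_F iF => /(integrableS measurableT mA (@subsetT _ A)).
  by apply: eq_integrable => // x /set_mem Ax; rewrite EL.
congr fine.
transitivity (\int[m1]_x \int[m2]_y F (x, y))%E.
  rewrite integral_mkcond; apply: eq_integral => x _; rewrite patchE.
  case: ifPn => [/set_mem Ax|xA]; first exact: EL.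
  rewrite integral0_eq// => y _.
  by rewrite /F /= indicE (negbTE xA) !mul0r.
rewrite Fubini// [RHS]integral_mkcond; apply: eq_integral => y _; rewrite patchE.
case: ifPn => [/set_mem By|yB].
  rewrite EFinM fineK; last by apply: integrable_fin_num => //; exact: iky.
  rewrite -integralZr//; last exact: iky.
  rewrite [RHS]integral_mkcond; apply: eq_integral => x _.
  rewrite /F /= !patchE mem_set//= indicE.
  by case: (_ \in _); rewrite ?mul1r ?mul0r.
rewrite integral0_eq// => x _.
by rewrite /F /= patchE (negbTE yB) mulr0.
Qed.

(** * Integrals over the circle and Fourier multipliers of convolutions *)

Lemma measurable_angles (R : realType) : measurable (@angles R).
Proof. exact: measurable_itv. Qed.

Lemma lebesgue_measure_angles (R : realType) :
  lebesgue_measure (@angles R) = (2 * pi)%:E :> \bar R.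
Proof.
rewrite /angles lebesgue_measure_itv/= lte_fin sube0.
by rewrite mulr_gt0 ?pi_gt0.
Qed.

Lemma integrable_angles (R : realType) (u : R -> R) (M : R) :
  measurable_fun setT u -> (forall x, `|u x| <= M) ->
  (@lebesgue_measure R).-integrable (@angles R) (EFin \o u).
Proof.
move=> mu uM; apply: (@bounded_integrable _ _ _ M) => //.
- exact: measurable_angles.
- by rewrite lebesgue_measure_angles ltry.
- exact: measurable_funTS.
Qed.

Lemma integrable_angles_mul (R : realType) (u h : R -> R) (M : R) :
  measurable_fun setT u -> (forall x, `|u x| <= M) ->
  (@lebesgue_measure R).-integrable (@angles R) (EFin \o h) ->
  (@lebesgue_measure R).-integrable (@angles R) (fun x => (u x * h x)%:E).
Proof.
move=> mu uM ih.
have := @integrableMr _ _ _ lebesgue_measure (@angles R) (@measurable_angles R)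
  u (EFin \o h).
apply => //; first exact: measurable_funTS.
exists M; split; first exact: num_real.
by move=> r Mr y _; apply: le_trans (uM y) (ltW Mr).
Qed.

(** The reflection x -> 2 pi - x preserves [0, 2 pi] and sends [u] to its opposite, so the integral
    equals its own negative. *)
Lemma Rintegral_odd_periodic (R : realType) (u : R -> R) (M : R) :
  measurable_fun setT u -> (forall x, `|u x| <= M) ->
  (forall x, u (x + 2 * pi) = u x) -> (forall x, u (- x) = - u x) ->
  \int[lebesgue_measure]_(x in @angles R) u x = 0.
Proof.
move=> mu uM uP uN.
have E : \int[lebesgue_measure]_(x in @angles R) u x =
         \int[lebesgue_measure]_(x in @angles R) (- u x).
  have angE : @angles R = `[(2 * pi - 2 * pi), (2 * pi - 0)]%classic.
    by rewrite subrr subr0.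
  rewrite {1}/Rintegral {1}angE -integral_reflect; last exact/measurable_EFinP.
  by congr fine; apply: eq_integral => x _; rewrite addrC uP uN.
have : \int[lebesgue_measure]_(x in @angles R) (-1 * u x) =
       -1 * \int[lebesgue_measure]_(x in @angles R) u x.
  by apply: RintegralZl; [exact: measurable_angles|exact: integrable_angles uM].
rewrite mulN1r; under eq_Rintegral do rewrite mulN1r.
by rewrite -E; move {E}; move: (Rintegral _ _ _) => I ?; lra.
Qed.

Lemma periodic_mulrz (R : realType) (f : R -> R) (P : R) (n : int) (x : R) :
  (forall x, f (x + P) = f x) -> f (x + P *~ n) = f x.
Proof.
move=> fP; have aux (m : nat) (y : R) : f (y + P *+ m) = f y.
  by elim: m y => [|m IH] y; rewrite ?mulr0n ?addr0// mulrSr addrA fP IH.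
case: n => m; first by rewrite -pmulrn aux.
by rewrite NegzE mulrNz -pmulrn -(aux m.+1) subrK.
Qed.

Lemma normr_cos_le1 (R : realType) (x : R) : `|cos x| <= 1.
Proof. by rewrite ler_norml cos_geN1 cos_le1. Qed.

Lemma normr_sin_le1 (R : realType) (x : R) : `|sin x| <= 1.
Proof. by rewrite ler_norml sin_geN1 sin_le1. Qed.

(* The identity required of [e] and [b] is an addition formula: it holds for
   [e = cos (n _)], [b = - sin (n _)] and for [e = sin (n _)], [b = cos (n _)]. *)
Lemma Rintegral_circle_convolution (R : realType) (n : int) (g h e b : R -> R)
    (M : R) :
  measurable_fun setT g -> (forall x, `|g x| <= M) ->
  (forall x, g (x + 2 * pi) = g x) -> (forall x, g (- x) = g x) ->
  (@lebesgue_measure R).-integrable (@angles R) (EFin \o h) ->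
  measurable_fun setT e -> (forall x, `|e x| <= 1) ->
  (forall x y, e x = e y * cos (n%:~R * (x - y)) + b y * sin (n%:~R * (x - y))) ->
  (@lebesgue_measure R).-integrable (@angles R) (fun x =>
    (\int[lebesgue_measure]_(y in @angles R) (g (x - y) * h y) * e x)%:E) /\
  \int[lebesgue_measure]_(x in @angles R)
    (\int[lebesgue_measure]_(y in @angles R) (g (x - y) * h y) * e x) =
  \int[lebesgue_measure]_(x in @angles R) (g x * cos (n%:~R * x)) *
  \int[lebesgue_measure]_(x in @angles R) (h x * e x).
Proof.
move=> mg gM gP gN ih me e1 eE.
have mB : measurable_fun setT (fun z : R * R => z.1 - z.2).
  by apply: measurable_funB; [exact: measurable_fst|exact: measurable_snd].
have mk : measurable_fun setT (fun z : R * R => e z.1 * g (z.1 - z.2)).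
  apply: measurable_funM; first exact: measurableT_comp me measurable_fst.
  exact: measurableT_comp mg mB.
have mgx (x : R) : measurable_fun setT (fun y : R => g (x - y)).
  apply: measurableT_comp => //.
  by apply: continuous_measurable_fun => y; apply: cvgB => //; exact: cvg_cst.
have kM x y : `|e x * g (x - y)| <= M.
  by rewrite normrM -[M]mul1r ler_pM.
have mky (y : R) : measurable_fun setT (fun x : R => e x * g (x - y)).
  apply: measurable_funM => //; apply: measurableT_comp => //.
  by apply: continuous_measurable_fun => x; apply: cvgB => //; exact: cvg_cst.
have kC (y : R) : @angles R y ->
    (\int[lebesgue_measure]_(x in @angles R) (`|e x * g (x - y)|)%:E
      <= (M * (2 * pi))%:E)%E.
  move=> _; rewrite EFinM -lebesgue_measure_angles.
  rewrite -integral_cst; last exact: measurable_angles.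
  apply: ge0_le_integral => //.
  - exact: measurable_angles.
  - apply/measurable_EFinP/measurable_funTS.
    exact: measurableT_comp (@normr_measurable R setT) (mky y).
  - by move=> x _; rewrite lee_fin.
have [ik Ek] := Rintegral_exchange (m1 := lebesgue_measure)
  (m2 := lebesgue_measure) (@measurable_angles R) (@measurable_angles R) mk ih kC
  (fun x _ => ex_intro _ M (fun y _ => kM x y)).
have pull x : \int[lebesgue_measure]_(y in @angles R) (g (x - y) * h y) * e x =
    \int[lebesgue_measure]_(y in @angles R) (e x * g (x - y) * h y).
  rewrite -RintegralZr; last 2 first.
  - exact: measurable_angles.
  - exact: integrable_angles_mul (mgx x) _ ih.
  by apply: eq_Rintegral => y _; rewrite mulrC mulrA.
split; first by under eq_fun do rewrite pull.
under eq_Rintegral do rewrite pull.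
rewrite Ek -RintegralZl; last 2 first.
- exact: measurable_angles.
- have := integrable_angles_mul me e1 ih.
  by under eq_fun do rewrite mulrC.
apply: eq_Rintegral => y /set_mem; rewrite /angles/= in_itv/= => yP.
rewrite [RHS]mulrCA mulrC; congr (_ * _).
have mn (f : R -> R) : continuous f -> measurable_fun setT (fun x : R => g x * f (n%:~R * x)).
  move=> cf; apply: measurable_funM => //; apply: measurableT_comp.
    exact: continuous_measurable_fun.
  by apply: continuous_measurable_fun => x; apply: cvgMr; exact: cvg_id.
have gc1 (f : R -> R) x : (forall x, `|f x| <= 1) -> `|g x * f (n%:~R * x)| <= M.
  by move=> f1; rewrite normrM -[M]mulr1 ler_pM.
have nP (f : R -> R) x : (forall x, f (x + 2 * pi) = f x) ->
    f (n%:~R * (x + 2 * pi)) = f (n%:~R * x).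
  by move=> fP; rewrite mulrDr [n%:~R * (2 * pi)]mulrzl (periodic_mulrz n _ fP).
(* By [eE], e x * g (x - y) = p (x - y), and periodicity removes the shift by [y]. The sine term is
   odd because [g] is even, so only [e y] times the cosine integral survives. *)
pose p x := e y * (g x * cos (n%:~R * x)) + b y * (g x * sin (n%:~R * x)).
have ic : (@lebesgue_measure R).-integrable (@angles R)
    (EFin \o (fun x => g x * cos (n%:~R * x))).
  apply: (@integrable_angles _ _ M); first exact: mn (@continuous_cos R).
  by move=> x; apply: gc1; exact: normr_cos_le1.
have isn : (@lebesgue_measure R).-integrable (@angles R)
    (EFin \o (fun x => g x * sin (n%:~R * x))).
  apply: (@integrable_angles _ _ M); first exact: mn (@continuous_sin R).
  by move=> x; apply: gc1; exact: normr_sin_le1.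
have iZ c (f : R -> R) : (@lebesgue_measure R).-integrable (@angles R) (EFin \o f) ->
    (@lebesgue_measure R).-integrable (@angles R) (EFin \o (fun x => c * f x)).
  move=> fi; rewrite (_ : EFin \o _ = (fun x => c%:E * (EFin \o f) x)%E).
    by apply: integrableZl => //; exact: measurable_angles.
  by apply/funext => x; rewrite /= EFinM.
transitivity (\int[lebesgue_measure]_(x in @angles R) p x).
  rewrite -(@Rintegral_periodic R (2 * pi) y p (`|e y| * M + `|b y| * M))//.
  - by apply: eq_Rintegral => x _; rewrite (eE x y) /p; ring.
  - by apply: measurable_funD; apply: measurable_funM => //;
      [exact: mn (@continuous_cos R)|exact: mn (@continuous_sin R)].
  - move=> x; apply: le_trans (ler_normD _ _) _; rewrite !(normrM (e y), normrM (b y)).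
    by apply: lerD; apply: ler_wpM2l => //; apply: gc1 => z;
      [exact: normr_cos_le1|exact: normr_sin_le1].
  - by move=> x; rewrite /p gP !nP => [//|z|z]; rewrite mulr_natl ?sinD2pi ?cosD2pi.
rewrite /p RintegralD; [|exact: measurable_angles|exact: iZ..].
rewrite !RintegralZl; [|exact: measurable_angles|by []|exact: measurable_angles|by []].
rewrite (@Rintegral_odd_periodic _ (fun x => g x * sin (n%:~R * x)) M); last 4 first.
- exact: mn (@continuous_sin R).
- by move=> x; apply: gc1; exact: normr_sin_le1.
- by move=> x; rewrite gP nP// => z; rewrite mulr_natl sinD2pi.
- by move=> x; rewrite gN mulrN sinN mulrN.
by rewrite mulr0 addr0 mulrC.
Qed.

(** * The kernel of one time step *)

(** Inversion is continuous on the open complement of 0, and on a singleton every function is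
    measurable. *)
Lemma measurable_inv (R : realType) : measurable_fun setT (fun x : R => x^-1).
Proof.
rewrite -(setvU [set (0 : R)]); apply/measurable_funU => //.
  exact: measurableC.
split; last exact: measurable_fun_set1.
apply: open_continuous_measurable_fun.
  by apply: closed_openC; exact: closed_eq.
by move=> x /set_mem/= /eqP x0; exact: inv_continuous.
Qed.

Lemma measurable_circle_dist (R : realType) :
  measurable_fun setT (fun s : R => 1 - cos s).
Proof.
apply: continuous_measurable_fun => x; apply: cvgB; first exact: cvg_cst.
exact: continuous_cos.
Qed.

Lemma circle_dist_ge0 (R : realType) (s : R) : 0 <= 1 - cos s.
Proof. by rewrite subr_ge0 cos_le1. Qed.

Lemma circle_dist_le2 (R : realType) (s : R) : 1 - cos s <= 2.
Proof. by have := cos_geN1 s; lra. Qed.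

Lemma measurable_heat_exp (R : realType) (t : R) :
  measurable_fun setT (fun s : R => heat_exp (1 - cos s) t).
Proof.
suff mH : measurable_fun setT (fun a : R => heat_exp a t).
  exact: measurableT_comp mH (@measurable_circle_dist R).
rewrite /heat_exp; case: (t == 0).
  rewrite (_ : (fun a : R => (a == 0)%:R) = \1_[set (0 : R)]); first exact: measurable_indic.
  by apply/funext => a; rewrite indicE; have [->|/eqP a0] := eqVneq a 0;
    [rewrite mem_set|rewrite memNset].
apply: measurableT_comp; first exact: measurable_expR.
by apply: continuous_measurable_fun => a; apply: cvgN; apply: cvgMl; exact: cvg_id.
Qed.

(** The g_l of the overview, written in integrated form so that sums over l telescope. The index
    starts at 0: lags run from l dt to (l+1) dt, and l = 0 is the step that touches the
    singularity. *)
Definition step_kernel (R : realType) (dt : R) (l : nat) (s : R) : R :=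
  (heat_exp (1 - cos s) (l.+1%:R * dt) - heat_exp (1 - cos s) (l%:R * dt)) /
  (4 * pi).

Lemma step_kernel_ge0 (R : realType) (dt : R) (l : nat) (s : R) :
  0 < dt -> 0 <= step_kernel dt l s.
Proof.
move=> dt0; rewrite divr_ge0 ?mulr_ge0 ?pi_ge0// subr_ge0.
apply: heat_exp_mono.
- exact: circle_dist_ge0.
- by rewrite mulr_ge0 ?(ltW dt0).
- by rewrite ler_pM2r// ler_nat.
Qed.

Lemma step_kernel_le (R : realType) (dt : R) (l : nat) (s : R) :
  0 < dt -> step_kernel dt l s <= (4 * pi)^-1.
Proof.
move=> dt0; rewrite -[leRHS]mul1r ler_wpM2r ?invr_ge0 ?mulr_ge0 ?pi_ge0//.
have h1 : heat_exp (1 - cos s) (l.+1%:R * dt) <= 1.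
  by rewrite heat_exp_le1 ?circle_dist_ge0// mulr_ge0 ?(ltW dt0).
by have := heat_exp_ge0 (1 - cos s) (l%:R * dt); lra.
Qed.

Lemma measurable_step_kernel (R : realType) (dt : R) (l : nat) :
  measurable_fun setT (step_kernel dt l).
Proof.
apply: measurable_funM => //.
by apply: measurable_funB; exact: measurable_heat_exp.
Qed.

Lemma step_kernel_periodic (R : realType) (dt : R) (l : nat) (s : R) :
  step_kernel dt l (s + 2 * pi) = step_kernel dt l s.
Proof. by rewrite /step_kernel mulr_natl cosD2pi. Qed.

Lemma step_kernelN (R : realType) (dt : R) (l : nat) (s : R) :
  step_kernel dt l (- s) = step_kernel dt l s.
Proof. by rewrite /step_kernel cosN. Qed.

Lemma double_layer_kernelE (R : realType) (x y t : R) :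
  double_layer_kernel (circle_pt x) (circle_pt y) t =
  - heat_flux (1 - cos (x - y)) t.
Proof. by rewrite /double_layer_kernel /heat_flux /dot2 /= cosB mulNr. Qed.

(** The substitution t = j dt - tau carries the k-th step to the lags between (j-k-1) dt and (j-k)
    dt, whence the index [j - k.+1]. *)
Lemma integral_heat_flux_step (R : realType) (dt s : R) (j k : nat) :
  0 < dt -> (k < j)%N ->
  (\int[lebesgue_measure]_(tau in `[(k%:R * dt)%R, (k.+1%:R * dt)%R])
     (heat_flux (1 - cos s) (j%:R * dt - tau)%R)%:E =
   (step_kernel dt (j - k.+1) s)%:E)%E.
Proof.
move=> dt0 kj.
have mflux : measurable_fun setT (heat_flux (1 - cos s)).
  apply: measurable_funM; first apply: measurable_funM => //.
    apply: measurableT_comp; first exact: measurable_inv.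
    by apply: continuous_measurable_fun => x; apply: cvgMr; exact: exprn_continuous.
  apply: measurableT_comp; first exact: measurable_expR.
  apply: measurableT_comp => //; apply: measurable_funM => //.
  apply: measurableT_comp; first exact: measurable_inv.
  by apply: continuous_measurable_fun => x; apply: cvgMr; exact: cvg_id.
have sk : (j - k = (j - k.+1).+1)%N by rewrite subnSK.
rewrite (@integral_reflect R (j%:R * dt) _ _
  (fun t => (heat_flux (1 - cos s) t)%:E)); last exact/measurable_EFinP.
have diffE m : (m <= j)%N -> j%:R * dt - m%:R * dt = (j - m)%:R * dt :> R.
  by move=> mj; rewrite -mulrBl natrB.
rewrite !diffE//; last exact: ltnW.
rewrite (integral_heat_flux (circle_dist_ge0 s)).
- by rewrite sk.
- by rewrite mulr_ge0 ?(ltW dt0).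
- by rewrite ltr_pM2r// ltr_nat sk.
Qed.

(** At lag t the kernel reaches the order 1/t, where 1 - cos (x - y) = 2t, so for [k.+1 = j] it is
    not jointly bounded. What allows the exchange is that, at fixed y, its absolute value integrates
    in time to a step kernel, which is at most 1/(4 pi). *)
Lemma Rintegral_double_layer (R : realType) (dt x : R) (j k : nat) (h : R -> R) :
  0 < dt -> (k < j)%N ->
  (@lebesgue_measure R).-integrable (@angles R) (EFin \o h) ->
  \int[lebesgue_measure]_(tau in `[k%:R * dt, k.+1%:R * dt])
    (\int[lebesgue_measure]_(y in @angles R)
      (double_layer_kernel (circle_pt x) (circle_pt y) (j%:R * dt - tau) * h y)) =
  - \int[lebesgue_measure]_(y in @angles R) (step_kernel dt (j - k.+1) (x - y) * h y).
Proof.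
move=> dt0 kj ih.
pose A : set R := `[k%:R * dt, k.+1%:R * dt]%classic.
pose K (z : R * R) := double_layer_kernel (circle_pt x) (circle_pt z.2) (j%:R * dt - z.1).
have KE z : K z = - heat_flux (1 - cos (x - z.2)) (j%:R * dt - z.1).
  by rewrite /K double_layer_kernelE.
have nKE z : `|K z| = heat_flux (1 - cos (x - z.2)) (j%:R * dt - z.1).
  by rewrite KE normrN ger0_norm// heat_flux_ge0// circle_dist_ge0.
have mt : measurable_fun setT (fun z : R * R => j%:R * dt - z.1).
  by apply: measurable_funB => //; exact: measurable_fst.
have ma : measurable_fun setT (fun z : R * R => 1 - cos (x - z.2)).
  apply: measurableT_comp (@measurable_circle_dist R) _.
  by apply: measurable_funB => //; exact: measurable_snd.
have mK : measurable_fun setT K.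
  rewrite (_ : K = fun z => - heat_flux (1 - cos (x - z.2)) (j%:R * dt - z.1));
    last exact/funext.
  apply: measurable_funN; apply: measurable_funM.
    apply: measurable_funM => //; apply: measurableT_comp.
      exact: measurable_inv.
    by apply: measurable_funM => //; exact: measurable_funX.
  apply: measurableT_comp; first exact: measurable_expR.
  apply: measurable_funN; apply: measurable_funM => //.
  apply: measurableT_comp; first exact: measurable_inv.
  exact: measurable_funM.
have tau_le tau : A tau -> 0 <= j%:R * dt - tau.
  rewrite /A/= in_itv/= => /andP[_ tk]; rewrite subr_ge0 (le_trans tk)//.
  by rewrite ler_pM2r// ler_nat.
have kC y : @angles R y ->
    (\int[lebesgue_measure]_(tau in A) `|K (tau, y)|%:E <= (4 * pi)^-1%:E)%E.
  move=> _; under eq_integral do rewrite (nKE (_, _))/=.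
  by rewrite integral_heat_flux_step// lee_fin step_kernel_le.
have kM tau : A tau -> exists M, forall y, @angles R y -> `|K (tau, y)| <= M.
  move=> Atau; have den0 : 0 <= 8 * pi * (j%:R * dt - tau) ^+ 2.
    by rewrite mulr_ge0 ?sqr_ge0// mulr_ge0 ?pi_ge0.
  (* At lag 0 the inverse of 0 is 0, so the flux and this bound both vanish and the inequality
     persists. *)
  exists (2 / (8 * pi * (j%:R * dt - tau) ^+ 2)) => y _.
  rewrite (nKE (_, _))/= -[leRHS]mulr1; apply: ler_pM.
  + by rewrite divr_ge0 ?circle_dist_ge0.
  + by rewrite expR_ge0.
  + by rewrite ler_wpM2r ?circle_dist_le2// invr_ge0.
  + rewrite expR_le1 oppr_le0 divr_ge0 ?circle_dist_ge0//.
    by rewrite mulr_ge0 ?tau_le.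
have [_] := @Rintegral_exchange _ _ _ _ R lebesgue_measure lebesgue_measure A
  (@angles R) K h (4 * pi)^-1 (measurable_itv _) (@measurable_angles R) mK ih kC kM.
rewrite /K/= => ->.
rewrite -mulN1r -RintegralZl; last 2 first.
+ exact: measurable_angles.
+ apply: integrable_angles_mul ih.
  * apply: measurableT_comp; first exact: measurable_step_kernel.
    by apply: continuous_measurable_fun => y; apply: cvgB => //; exact: cvg_cst.
  * move=> y; rewrite ger0_norm; last exact: step_kernel_ge0.
    exact: step_kernel_le.
apply: eq_Rintegral => y _; rewrite mulrA mulN1r; congr (_ * _).
under eq_Rintegral do rewrite double_layer_kernelE.
rewrite /Rintegral; under eq_integral do rewrite EFinN.
by rewrite integral_ge0N ?integral_heat_flux_step// => tau _;
  rewrite lee_fin heat_flux_ge0 ?circle_dist_ge0.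
Qed.

(** * The scheme in Fourier modes *)

Lemma Rintegral_sum (d : measure_display) (T : measurableType d) (R : realType)
    (mu : {measure set T -> \bar R}) (D : set T) (I : Type) (r : seq I)
    (P : pred I) (F : I -> T -> R) :
  measurable D ->
  (forall i, P i -> mu.-integrable D (EFin \o F i)) ->
  mu.-integrable D (EFin \o (fun x => \sum_(i <- r | P i) F i x)) /\
  \int[mu]_(x in D) (\sum_(i <- r | P i) F i x) =
  \sum_(i <- r | P i) \int[mu]_(x in D) F i x.
Proof.
move=> mD iF; elim: r => [|i r [IHi IHe]].
  split.
    rewrite (_ : EFin \o _ = cst 0%E); first exact: integrable0.
    by apply/funext => x; rewrite /= big_nil.
  rewrite big_nil; under eq_Rintegral do rewrite big_nil.
  by rewrite Rintegral_cst// mul0r.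
rewrite big_cons; case: ifPn => Pi; last first.
  rewrite (_ : (fun x => \sum_(_ <- _ | _) _) = (fun x => \sum_(i <- r | P i) F i x))//.
  by apply/funext => x; rewrite big_cons (negbTE Pi).
have E : (fun x => \sum_(k <- i :: r | P k) F k x) =
    (fun x => F i x + \sum_(k <- r | P k) F k x).
  by apply/funext => x; rewrite big_cons Pi.
rewrite E; split; last by rewrite RintegralD ?IHe//; exact: iF.
rewrite (_ : EFin \o _ =
  ((EFin \o F i) \+ (EFin \o (fun x => \sum_(k <- r | P k) F k x)%R))%E)//.
by apply: integrableD => //; exact: iF.
Qed.

(** The entry v^n_{l+1} of V^n. A cosine integral is the full Fourier coefficient here because the
    step kernel is even. *)
Definition step_multiplier (R : realType) (dt : R) (n : int) (l : nat) : R :=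
  \int[lebesgue_measure]_(x in @angles R) (step_kernel dt l x * cos (n%:~R * x)).

(** The form is real so that it can serve four times: [u] and [v] are the real or the imaginary
    parts of the solution and the data, and [e] is a cosine or a sine. Each convolution becomes a
    product by [Rintegral_circle_convolution]. *)
Lemma Rintegral_euler_test (R : realType) (n : int) (dt : R) (N : nat)
    (j : 'I_N.+1) (u : 'I_N.+1 -> R -> R) (v e b : R -> R) :
  0 < dt ->
  (forall k, (@lebesgue_measure R).-integrable (@angles R) (EFin \o u k)) ->
  (@lebesgue_measure R).-integrable (@angles R) (EFin \o v) ->
  {ae @lebesgue_measure R, forall x, angles x ->
    (- 2^-1 * u j x + \sum_(k < N.+1 | (k < j)%N)
      - \int[lebesgue_measure]_(y in @angles R)
          (step_kernel dt (j - k.+1) (x - y) * u k y))%R = v x} ->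
  measurable_fun setT e -> (forall x, `|e x| <= 1) ->
  (forall x y, e x = e y * cos (n%:~R * (x - y)) + b y * sin (n%:~R * (x - y))) ->
  \int[lebesgue_measure]_(x in @angles R) (v x * e x) =
  - 2^-1 * \int[lebesgue_measure]_(x in @angles R) (u j x * e x) -
  \sum_(k < N.+1 | (k < j)%N) step_multiplier dt n (j - k.+1) *
    \int[lebesgue_measure]_(x in @angles R) (u k x * e x).
Proof.
move=> dt0 iu iv uv me e1 eE.
pose w (k : 'I_N.+1) x := \int[lebesgue_measure]_(y in @angles R)
  (step_kernel dt (j - k.+1) (x - y) * u k y) * e x.
have gM l x : `|step_kernel dt l x| <= (4 * pi)^-1 :> R.
  by rewrite ger0_norm ?step_kernel_ge0// step_kernel_le.
have wP (k : 'I_N.+1) := Rintegral_circle_convolution (measurable_step_kernel dt (j - k.+1))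
  (gM _) (step_kernel_periodic dt _) (step_kernelN dt _) (iu k) me e1 eE.
have iw k : (@lebesgue_measure R).-integrable (@angles R) (EFin \o (fun x => -1 * w k x)).
  rewrite (_ : EFin \o _ = (fun x => (-1)%:E * (EFin \o w k) x)%E).
    by apply: integrableZl; [exact: measurable_angles|exact: (wP k).1].
  by apply/funext => x; rewrite /= EFinM.
have ie h : (@lebesgue_measure R).-integrable (@angles R) (EFin \o h) ->
    (@lebesgue_measure R).-integrable (@angles R) (EFin \o (fun x => h x * e x)).
  move=> ih; have := integrable_angles_mul me e1 ih.
  by rewrite (_ : (fun x => _) = (EFin \o (fun x => h x * e x)))//;
    apply/funext => x /=; rewrite mulrC.
have iuj : (@lebesgue_measure R).-integrable (@angles R)
    (EFin \o (fun x => - 2^-1 * (u j x * e x))).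
  rewrite (_ : EFin \o _ = (fun x => (- 2^-1)%:E * (EFin \o (fun x => u j x * e x)%R) x)%E).
    by apply: integrableZl; [exact: measurable_angles|exact: ie].
  by apply/funext => x; rewrite /= EFinM.
have [isum Esum] := @Rintegral_sum _ _ R (@lebesgue_measure R) (@angles R) _
  (index_enum 'I_N.+1) (fun k => (k < j)%N) (fun k x => -1 * w k x)
  (@measurable_angles R) (fun k _ => iw k).
transitivity (\int[lebesgue_measure]_(x in @angles R)
    (- 2^-1 * (u j x * e x) + \sum_(k < N.+1 | (k < j)%N) (-1 * w k x))).
  congr fine; apply: ae_eq_integral.
  - exact: measurable_angles.
  - exact: measurable_int (ie _ iv).
  - apply: (measurable_int lebesgue_measure).
    rewrite (_ : (fun x => _) = ((EFin \o (fun x => - 2^-1 * (u j x * e x))%R) \+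
      (EFin \o (fun x => \sum_(k < N.+1 | (k < j)%N) (-1 * w k x))%R))%E)//.
    by apply: integrableD => //; exact: measurable_angles.
  - apply: filterS uv; first exact: (ae_filter_ringOfSetsType lebesgue_measure).
    move=> x uvx /uvx <-; congr (_%:E).
    rewrite mulrDl mulrA; congr (_ + _); rewrite big_distrl/=.
    by apply: eq_bigr => k _; rewrite mulN1r mulNr.
rewrite RintegralD//; last exact: measurable_angles.
rewrite RintegralZl; [|exact: measurable_angles|exact: ie].
congr (_ + _); rewrite Esum -sumrN; apply: eq_bigr => k _.
rewrite RintegralZl; [|exact: measurable_angles|exact: (wP k).1].
by rewrite mulN1r (wP k).2.
Qed.

(** The circle has finite length, and |a| <= 1 + a^2. *)
Lemma circle_L2_integrable (R : realType) (g : R * R -> R[i]) :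
  circle_L2 g ->
  (@lebesgue_measure R).-integrable (@angles R)
    (EFin \o (fun x => complex.Re (g (circle_pt x)))) /\
  (@lebesgue_measure R).-integrable (@angles R)
    (EFin \o (fun x => complex.Im (g (circle_pt x)))).
Proof.
move=> [mre mim i2].
have i1 : (@lebesgue_measure R).-integrable (@angles R) (EFin \o cst 1).
  by apply: (@integrable_angles _ _ 1) => // x; rewrite normr1.
have ib : (@lebesgue_measure R).-integrable (@angles R) ((EFin \o cst 1%R) \+
    (fun x => (ComplexField.Normc.normc (g (circle_pt x)) ^+ 2)%R%:E))%E.
  by apply: integrableD => //; exact: measurable_angles.
have normc2 (z : R[i]) :
    ComplexField.Normc.normc z ^+ 2 = complex.Re z ^+ 2 + complex.Im z ^+ 2.
  by case: z => a b /=; rewrite sqr_sqrtr ?addr_ge0 ?sqr_ge0.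
have le1D (a c : R) : 0 <= c -> `|a| <= `|1 + (a ^+ 2 + c)|.
  move=> c0; rewrite [leRHS]ger0_norm; last by rewrite !addr_ge0 ?sqr_ge0.
  rewrite -[a ^+ 2]real_normK ?num_real//.
  by have := sqr_ge0 (`|a| - 1); have := normr_ge0 a; nra.
split; apply: le_integrable ib => //; try exact: measurable_angles;
  try (by apply/measurable_EFinP); move=> x _ /=; rewrite lee_fin normc2.
  by apply: le1D; exact: sqr_ge0.
by rewrite [X in 1 + X]addrC; apply: le1D; exact: sqr_ge0.
Qed.

Lemma Re_sum (R : rcfType) (I : Type) (r : seq I) (P : pred I) (F : I -> R[i]) :
  complex.Re (\sum_(i <- r | P i) F i) = \sum_(i <- r | P i) complex.Re (F i).
Proof. by apply: (big_morph _ _ (erefl _)) => -[a b] [c d]. Qed.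

Lemma Im_sum (R : rcfType) (I : Type) (r : seq I) (P : pred I) (F : I -> R[i]) :
  complex.Im (\sum_(i <- r | P i) F i) = \sum_(i <- r | P i) complex.Im (F i).
Proof. by apply: (big_morph _ _ (erefl _)) => -[a b] [c d]. Qed.

Lemma Re_realM (R : rcfType) (a : R) (z : R[i]) :
  complex.Re (a%:C * z) = a * complex.Re z.
Proof. by case: z => b c /=; rewrite mul0r subr0. Qed.

Lemma Im_realM (R : rcfType) (a : R) (z : R[i]) :
  complex.Im (a%:C * z) = a * complex.Im z.
Proof. by case: z => b c /=; rewrite mul0r addr0. Qed.

Lemma complex_eqP (R : rcfType) (z w : R[i]) :
  complex.Re z = complex.Re w -> complex.Im z = complex.Im w -> z = w.
Proof. by case: z w => a b [c d] /= -> ->. Qed.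

Lemma Re_euler_lhs (R : realType) (N : nat) (dt : R)
    (sigma : 'I_N.+1 -> R * R -> R[i]) (j : 'I_N.+1) (x : R) :
  0 < dt -> (forall k, circle_L2 (sigma k)) ->
  complex.Re (euler_lhs dt sigma j (circle_pt x)) =
  - 2^-1 * complex.Re (sigma j (circle_pt x)) +
  \sum_(k < N.+1 | (k < j)%N)
    - \int[lebesgue_measure]_(y in @angles R)
        (step_kernel dt (j - k.+1) (x - y) * complex.Re (sigma k (circle_pt y))).
Proof.
move=> dt0 L2; rewrite /euler_lhs.
have ReD (z w : R[i]) : complex.Re (z + w) = complex.Re z + complex.Re w.
  by case: z w => a b [].
rewrite ReD Re_realM Re_sum; congr (_ + _); apply: eq_bigr => k kj.
rewrite -(@Rintegral_double_layer R dt x j k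
  (fun y => complex.Re (sigma k (circle_pt y))) dt0 kj
  (circle_L2_integrable (L2 k)).1).
apply: eq_Rintegral => tau _; apply: eq_Rintegral => y _.
by rewrite Re_realM.
Qed.

Lemma Im_euler_lhs (R : realType) (N : nat) (dt : R)
    (sigma : 'I_N.+1 -> R * R -> R[i]) (j : 'I_N.+1) (x : R) :
  0 < dt -> (forall k, circle_L2 (sigma k)) ->
  complex.Im (euler_lhs dt sigma j (circle_pt x)) =
  - 2^-1 * complex.Im (sigma j (circle_pt x)) +
  \sum_(k < N.+1 | (k < j)%N)
    - \int[lebesgue_measure]_(y in @angles R)
        (step_kernel dt (j - k.+1) (x - y) * complex.Im (sigma k (circle_pt y))).
Proof.
move=> dt0 L2; rewrite /euler_lhs.
have ImD (z w : R[i]) : complex.Im (z + w) = complex.Im z + complex.Im w.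
  by case: z w => a b [].
rewrite ImD Im_realM Im_sum; congr (_ + _); apply: eq_bigr => k kj.
rewrite -(@Rintegral_double_layer R dt x j k
  (fun y => complex.Im (sigma k (circle_pt y))) dt0 kj
  (circle_L2_integrable (L2 k)).2).
apply: eq_Rintegral => tau _; apply: eq_Rintegral => y _.
by rewrite Im_realM.
Qed.

Lemma fourier_coefE (R : realType) (g : R * R -> R[i]) (n : int)
    (re := fun x => complex.Re (g (circle_pt x)))
    (im := fun x => complex.Im (g (circle_pt x)))
    (c := fun x => cos (n%:~R * x)) (s := fun x => sin (n%:~R * x)) :
  circle_L2 g ->
  fourier_coef g n = ((2 * pi)^-1)%:C *
   ((\int[lebesgue_measure]_(x in @angles R) (re x * c x) +
     \int[lebesgue_measure]_(x in @angles R) (im x * s x)) +i*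
    (\int[lebesgue_measure]_(x in @angles R) (im x * c x) -
     \int[lebesgue_measure]_(x in @angles R) (re x * s x))).
Proof.
move=> /circle_L2_integrable[ire iim].
have mn (f : R -> R) : continuous f -> measurable_fun setT (fun x : R => f (n%:~R * x)).
  move=> cf; apply: measurableT_comp; first exact: continuous_measurable_fun.
  by apply: continuous_measurable_fun => x; apply: cvgMr; exact: cvg_id.
have ie (f h : R -> R) : continuous f -> (forall x, `|f x| <= 1) ->
    (@lebesgue_measure R).-integrable (@angles R) (EFin \o h) ->
    (@lebesgue_measure R).-integrable (@angles R)
      (EFin \o (fun x => h x * f (n%:~R * x))).
  move=> cf f1 ih.
  have := integrable_angles_mul (mn f cf) (fun x => f1 (n%:~R * x)) ih.
  by rewrite (_ : (fun x => _) = (EFin \o (fun x => h x * f (n%:~R * x))))//;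
    apply/funext => x /=; rewrite mulrC.
have cc := @continuous_cos R; have cs := @continuous_sin R.
have c1 := @normr_cos_le1 R; have s1 := @normr_sin_le1 R.
congr (_ * _); rewrite /cintegral; congr (_ +i* _).
  rewrite -RintegralD; [|exact: measurable_angles|exact: ie..].
  apply: eq_Rintegral => x _; rewrite /re /im /c /s.
  by case: (g _) => a b /=; ring.
rewrite -RintegralB; [|exact: measurable_angles|exact: ie..].
apply: eq_Rintegral => x _; rewrite /re /im /c /s.
by case: (g _) => a b /=; ring.
Qed.

(** Four real tests, of real and imaginary parts against cos and sin, recombine into the n-th
    coefficient because they share the same real multipliers. The result is row j of (-1/2 I - V^n)
    sigma^n = f^n. *)
Lemma fourier_mode_euler (R : realType) (N : nat) (dt : R)
    (f sigma : 'I_N.+1 -> R * R -> R[i]) (n : int) (j : 'I_N.+1) :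
  0 < dt -> forward_euler dt f sigma ->
  fourier_mode f n j 0 = (- 2^-1)%:C * fourier_mode sigma n j 0 -
    \sum_(k < N.+1 | (k < j)%N)
      (step_multiplier dt n (j - k.+1))%:C * fourier_mode sigma n k 0.
Proof.
move=> dt0 [fL2 _ sL2 /(_ j) eqs].
have mn (e : R -> R) : continuous e -> measurable_fun setT (fun x : R => e (n%:~R * x)).
  move=> ce; apply: measurableT_comp; first exact: continuous_measurable_fun.
  by apply: continuous_measurable_fun => x; apply: cvgMr; exact: cvg_id.
have cE (x y : R) : cos (n%:~R * x) = cos (n%:~R * y) * cos (n%:~R * (x - y)) +
    - sin (n%:~R * y) * sin (n%:~R * (x - y)).
  by rewrite mulNr -cosD -mulrDr addrC subrK.
have sE (x y : R) : sin (n%:~R * x) = sin (n%:~R * y) * cos (n%:~R * (x - y)) +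
    cos (n%:~R * y) * sin (n%:~R * (x - y)).
  by rewrite -sinD -mulrDr addrC subrK.
have aeF := ae_filter_ringOfSetsType (@lebesgue_measure R).
have re_ae := @filterS _ _ aeF _ _ (fun x (H : angles x -> _) ax =>
  etrans (esym (Re_euler_lhs j x dt0 sL2)) (congr1 (@complex.Re R) (H ax))) eqs.
have im_ae := @filterS _ _ aeF _ _ (fun x (H : angles x -> _) ax =>
  etrans (esym (Im_euler_lhs j x dt0 sL2)) (congr1 (@complex.Im R) (H ax))) eqs.
have ire k := (circle_L2_integrable (sL2 k)).1.
have iim k := (circle_L2_integrable (sL2 k)).2.
have [jre jim] := circle_L2_integrable (fL2 j).
have c1 x := @normr_cos_le1 R (n%:~R * x).
have s1 x := @normr_sin_le1 R (n%:~R * x).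
have mc := mn _ (@continuous_cos R).
have ms := mn _ (@continuous_sin R).
have rc := Rintegral_euler_test dt0 ire jre re_ae mc c1 cE.
have rs := Rintegral_euler_test dt0 ire jre re_ae ms s1 sE.
have ic := Rintegral_euler_test dt0 iim jim im_ae mc c1 cE.
have i_s := Rintegral_euler_test dt0 iim jim im_ae ms s1 sE.
rewrite !mxE fourier_coefE// fourier_coefE//.
under eq_bigr do rewrite mxE fourier_coefE//.
rewrite rc rs ic i_s; move: (2 * pi)^-1 => c.
have ReB (z w : R[i]) : complex.Re (z - w) = complex.Re z - complex.Re w.
  by case: z w => a b [].
have ImB (z w : R[i]) : complex.Im (z - w) = complex.Im z - complex.Im w.
  by case: z w => a b [].
apply: complex_eqP.
  rewrite ReB Re_sum !Re_realM.
  under [in RHS]eq_bigr do rewrite Re_realM Re_realM/= mulrCA [_ * (_ + _)]mulrDr.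
  by rewrite -mulr_sumr big_split/=; ring.
rewrite ImB Im_sum !Im_realM.
under [in RHS]eq_bigr do rewrite Im_realM Im_realM/= mulrCA [_ * (_ - _)]mulrBr.
by rewrite -mulr_sumr sumrB/=; ring.
Qed.

(** * The total mass of the step kernels *)

(** A shift by half a period changes the sign of cos but not its integral over a period. *)
Lemma Rintegral_cos_angles (R : realType) :
  \int[lebesgue_measure]_(x in @angles R) cos x = 0.
Proof.
have mc := continuous_measurable_fun (@continuous_cos R).
have pi0 := @pi_ge0 R.
have cP (x : R) : cos (x + 2 * pi) = cos x by rewrite mulr_natl cosD2pi.
have := @Rintegral_periodic R (2 * pi) pi cos 1 mc (@normr_cos_le1 R) cP.
rewrite pi0 mulr_natl mulr2n lerDl pi0 => /(_ isT).
under eq_Rintegral => x _ do rewrite cosB cospi sinpi mulr0 addr0 mulrC.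
rewrite RintegralZl//; last first.
  apply: (@bounded_integrable _ _ _ 1) => //.
  - exact: lebesgue_measure_itvcc_lty.
  - exact: measurable_funTS.
  - by move=> x _; exact: normr_cos_le1.
rewrite /angles mulr_natl mulr2n.
by move: (Rintegral _ _ _) => I IE; lra.
Qed.

(** Monotonicity in time replaces t by T. Then [1 <= T] and [a <= 2] put x = a/(2T) in [0, 1], the
    range where exp(-x) <= 1 - x/2 is proved. *)
Lemma heat_exp_le_linear (R : realType) (T t a : R) :
  1 <= T -> 0 < t -> t <= T -> 0 <= a -> a <= 2 ->
  heat_exp a t <= 1 - a / (4 * T).
Proof.
move=> T1 t0 tT a0 a2; have T0 : 0 < T by lra.
rewrite /heat_exp gt_eqF//.
have xT : a / (2 * T) <= a / (2 * t).
  by rewrite ler_wpM2l// lef_pV2 ?posrE ?mulr_gt0// ler_pM2l.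
pose x := a / (2 * T).
have x0 : 0 <= x by rewrite divr_ge0// mulr_ge0// ltW.
have x1 : x <= 1.
  rewrite /x ler_pdivrMr; last by rewrite mulr_gt0.
  by rewrite mul1r; lra.
apply: (@le_trans _ _ (expR (- x))); first by rewrite ler_expR lerN2.
rewrite (_ : a / (4 * T) = x / 2); last by rewrite /x; field; rewrite gt_eqF.
have e1 := expR_ge1Dx x.
rewrite expRN -[leLHS]mul1r ler_pdivrMr ?expR_gt0//.
(* Here (1 - x/2)(1 + x) - 1 = x(1 - x)/2 >= 0, and 1 + x <= exp x. *)
apply: (@le_trans _ _ ((1 - x / 2) * (1 + x))); first by nra.
by rewrite ler_wpM2l//; lra.
Qed.

Lemma sum_step_kernel (R : realType) (dt : R) (N : nat) (s : R) :
  \sum_(l < N) step_kernel dt l s =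
  (heat_exp (1 - cos s) (N%:R * dt) - heat_exp (1 - cos s) 0) / (4 * pi).
Proof.
rewrite -mulr_suml; congr (_ / _).
by rewrite -(big_mkord predT (fun l => heat_exp _ (l.+1%:R * dt) -
  heat_exp _ (l%:R * dt))) telescope_sumr// mul0r.
Qed.

Lemma integrable_step_kernel (R : realType) (dt : R) (l : nat) :
  0 < dt ->
  (@lebesgue_measure R).-integrable (@angles R) (EFin \o step_kernel dt l).
Proof.
move=> dt0; apply: (@integrable_angles _ _ (4 * pi)^-1).
  exact: measurable_step_kernel.
by move=> x; rewrite ger0_norm ?step_kernel_ge0// step_kernel_le.
Qed.

(* The deficit 1/(8T) from 1/2 is what makes the scheme stable: it comes from
   exp(-u) <= 1 - u/2 on [0, 1] with u = (1 - cos s)/(2T). *)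
Lemma sum_step_mass (R : realType) (T dt : R) (N : nat) :
  1 <= T -> 0 < dt -> (0 < N)%N -> N%:R * dt <= T ->
  \sum_(l < N) \int[lebesgue_measure]_(x in @angles R) step_kernel dt l x
  <= 2^-1 - (8 * T)^-1.
Proof.
move=> T1 dt0 N0 NT; have T0 : 0 < T by lra.
have [iS <-] := @Rintegral_sum _ _ R (@lebesgue_measure R) (@angles R) _
  (index_enum 'I_N) predT (fun l => step_kernel dt l) (@measurable_angles R)
  (fun l _ => integrable_step_kernel l dt0).
(* The pointwise bound (1 - (1 - cos x)/(4T))/(4 pi) is d + c cos x. Its cosine term integrates to
   0, and 2 pi d = 1/2 - 1/(8T). *)
pose c : R := (16 * pi * T)^-1.
pose d : R := (4 * pi)^-1 - c.
have ic : (@lebesgue_measure R).-integrable (@angles R) (EFin \o (fun x => c * cos x)).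
  apply: (@integrable_angles _ _ `|c|).
    apply: measurable_funM => //.
    exact: continuous_measurable_fun (@continuous_cos R).
  by move=> x; rewrite normrM ler_piMr// normr_cos_le1.
have id : (@lebesgue_measure R).-integrable (@angles R) (EFin \o (fun=> d)).
  by apply: (@integrable_angles _ _ `|d|).
apply: (@le_trans _ _ (\int[lebesgue_measure]_(x in @angles R) (d + c * cos x))).
  apply: le_Rintegral => //.
  - exact: measurable_angles.
  - rewrite (_ : EFin \o _ = ((EFin \o (fun=> d)) \+ (EFin \o (fun x => c * cos x)%R))%E)//.
    by apply: integrableD => //; exact: measurable_angles.
  - move=> x _; rewrite sum_step_kernel.
    have h := @heat_exp_le_linear _ T (N%:R * dt) (1 - cos x) T1 _ NT
      (circle_dist_ge0 x) (circle_dist_le2 x).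
    rewrite (_ : d + c * cos x = (1 - (1 - cos x) / (4 * T)) / (4 * pi)); last first.
      rewrite /d /c; move: (@pi_gt0 R); move: pi => p p0.
      by field; rewrite (gt_eqF p0) (gt_eqF T0).
    rewrite ler_wpM2r ?invr_ge0 ?mulr_ge0 ?pi_ge0//.
    apply: le_trans (h _); last by rewrite mulr_gt0// ltr0n.
    (* Dropping the value at time 0 leaves the integral unchanged: it vanishes except where cos x =
       1. *)
    by rewrite gerBl heat_exp_ge0.
rewrite RintegralD//; last exact: measurable_angles.
rewrite RintegralZl; [|exact: measurable_angles|]; last first.
  apply: (@integrable_angles _ _ 1); last exact: normr_cos_le1.
  exact: continuous_measurable_fun (@continuous_cos R).
rewrite Rintegral_cos_angles mulr0 addr0 Rintegral_cst; last exact: measurable_angles.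
rewrite (congr1 fine (lebesgue_measure_angles R)) /=.
rewrite /d /c le_eqVlt; apply/orP; left; apply/eqP.
move: (@pi_gt0 R); move: pi => p p0.
by field; rewrite (gt_eqF p0) (gt_eqF T0).
Qed.

(** * The discrete Volterra inequality *)

(** Along a row or a column of a strictly lower triangular Toeplitz matrix the lag is injective, so
    every row sum and every column sum is at most the sum of all weights. *)
Lemma sum_inj_le (R : numDomainType) (I : finType) (P : pred I) (N : nat)
    (phi : I -> nat) (a : nat -> R) :
  (forall l, 0 <= a l) -> (forall i, P i -> (phi i < N)%N) ->
  {in P &, injective phi} ->
  \sum_(i | P i) a (phi i) <= \sum_(l < N) a l.
Proof.
case: N => [|N] a0 phiN phiI.
  by rewrite big_pred0 ?big_ord0// => i; apply/negP => /phiN.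
have -> : \sum_(i | P i) a (phi i) =
    \sum_(l in ((fun i => inord (phi i) : 'I_N.+1) @: P)%SET) a l.
  rewrite big_imset/=; first by apply: eq_bigr => i Pi; congr (a _); exact/esym/inordK/phiN.
  move=> i k Pi Pk /(congr1 val) E; apply: phiI => //.
  by rewrite -(inordK (phiN _ Pi)) -(inordK (phiN _ Pk)); exact: E.
rewrite big_mkcond/=; apply: ler_sum => l _.
by case: ifP.
Qed.

(* Young's inequality for the discrete convolution, in energy form: test the
   scheme against s and split a s_k s_j by AM-GM. *)
Lemma discrete_volterra_energy (R : realFieldType) (N : nat) (d : R)
    (a : nat -> R) (s f : 'I_N.+1 -> R) :
  0 <= d -> (forall l, 0 <= a l) -> \sum_(l < N) a l <= 2^-1 - d ->
  (forall j, 0 <= s j) ->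
  (forall j, 2^-1 * s j <= f j +
     \sum_(k < N.+1 | (k < j)%N) a (j - k.+1)%N * s k) ->
  d ^+ 2 * \sum_j s j ^+ 2 <= \sum_j f j ^+ 2.
Proof.
move=> d0 a0 aA s0 sf; set S := \sum_j s j ^+ 2; set F := \sum_j f j ^+ 2.
pose A := \sum_(l < N) a l.
(* The two halves of s_j s_k <= (s_j^2 + s_k^2)/2: [C1] is controlled by row sums, [C2] by column
   sums. *)
pose C1 := \sum_(j < N.+1) \sum_(k < N.+1 | (k < j)%N) a (j - k.+1)%N * s j ^+ 2.
pose C2 := \sum_(j < N.+1) \sum_(k < N.+1 | (k < j)%N) a (j - k.+1)%N * s k ^+ 2.
have C1A : C1 <= A * S.
  rewrite /C1 /S mulr_sumr; apply: ler_sum => j _.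
  rewrite -mulr_suml ler_wpM2r ?sqr_ge0//.
  apply: (@sum_inj_le _ _ _ _ (fun k : 'I_N.+1 => j - k.+1)%N) => //.
    by move=> k kj; have := ltn_ord j; lia.
  move=> k l kj lj E; have {}kj : (k < j)%N := kj; have {}lj : (l < j)%N := lj.
  by apply/val_inj => /=; lia.
have C2A : C2 <= A * S.
  rewrite /C2 /S mulr_sumr (exchange_big_dep predT)//=; apply: ler_sum => k _.
  rewrite -mulr_suml ler_wpM2r ?sqr_ge0//.
  apply: (@sum_inj_le _ _ _ _ (fun j : 'I_N.+1 => j - k.+1)%N) => //.
    by move=> j kj; have := ltn_ord j; lia.
  move=> i l ki kl E; have {}ki : (k < i)%N := ki; have {}kl : (k < l)%N := kl.
  by apply/val_inj => /=; lia.
have E : 2^-1 * S <= \sum_j f j * s j + 2^-1 * (C1 + C2).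
  rewrite /S /C1 /C2 -big_split/= !mulr_sumr -big_split/=; apply: ler_sum => j _.
  rewrite -big_split/= mulr_sumr expr2 mulrA.
  apply: le_trans (ler_wpM2r (s0 j) (sf j)) _.
  rewrite mulrDl lerD2l mulr_suml; apply: ler_sum => k _.
  rewrite -mulrDr -mulrA [leRHS]mulrCA ler_wpM2l//.
  by have := sqr_ge0 (s j - s k); nra.
(* AM-GM with weight [d] stands in for Cauchy-Schwarz without square roots; combined with d S <= sum
   f_j s_j, half of d^2 S is absorbed on the left. *)
have G : d * \sum_j f j * s j <= 2^-1 * F + 2^-1 * (d ^+ 2 * S).
  rewrite /F /S !mulr_sumr -big_split/=; apply: ler_sum => j _.
  by have := sqr_ge0 (f j - d * s j); nra.
have S0 : 0 <= S by apply: sumr_ge0 => j _; exact: sqr_ge0.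
have H : d * S <= \sum_j f j * s j.
  have : A * S <= (2^-1 - d) * S by rewrite ler_wpM2r.
  by lra.
have : d * (d * S) <= d * \sum_j f j * s j by rewrite ler_wpM2l.
by rewrite mulrA -expr2; lra.
Qed.

(** * Moduli of the Fourier modes and the stability bound *)

Lemma normc_normE (R : rcfType) (z : R[i]) :
  `|z| = (ComplexField.Normc.normc z)%:C.
Proof. by case: z => a b; rewrite normc_def. Qed.

Lemma normc_realE (R : rcfType) (a : R) :
  ComplexField.Normc.normc a%:C = `|a|.
Proof. by rewrite /= expr0n addr0 sqrtr_sqr. Qed.

Lemma normcD_le (R : rcfType) (z w : R[i]) :
  ComplexField.Normc.normc (z + w) <=
  ComplexField.Normc.normc z + ComplexField.Normc.normc w.
Proof. by have := ler_normD z w; rewrite !normc_normE -rmorphD lecR. Qed.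

Lemma normc_sum_le (R : rcfType) (I : Type) (r : seq I) (P : pred I) (F : I -> R[i]) :
  ComplexField.Normc.normc (\sum_(i <- r | P i) F i) <=
  \sum_(i <- r | P i) ComplexField.Normc.normc (F i).
Proof.
apply: (big_ind2 (fun z b => ComplexField.Normc.normc z <= b)) => //.
  by rewrite ComplexField.Normc.normc0.
by move=> z b w c zb wc; apply: le_trans (normcD_le _ _) (lerD zb wc).
Qed.

Lemma normc_ge0 (R : rcfType) (z : R[i]) : 0 <= ComplexField.Normc.normc z.
Proof. by case: z => a b; exact: sqrtr_ge0. Qed.

(** Since the step kernel is nonnegative, its mass, which is the multiplier of mode 0, dominates all
    modes. This makes the final bound uniform in n. *)
Lemma step_multiplier_le (R : realType) (dt : R) (n : int) (l : nat) :
  0 < dt ->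
  `|step_multiplier dt n l| <=
  \int[lebesgue_measure]_(x in @angles R) step_kernel dt l x.
Proof.
move=> dt0; have mc : measurable_fun setT (fun x : R => cos (n%:~R * x)).
  apply: measurableT_comp; first exact: continuous_measurable_fun (@continuous_cos R).
  by apply: continuous_measurable_fun => x; apply: cvgMr; exact: cvg_id.
have mg : measurable_fun setT (fun x : R => step_kernel dt l x * cos (n%:~R * x)).
  by apply: measurable_funM => //; exact: measurable_step_kernel.
have gle (x : R) : `|step_kernel dt l x * cos (n%:~R * x)| <= step_kernel dt l x.
  by rewrite normrM ger0_norm ?step_kernel_ge0// ler_piMr ?step_kernel_ge0// normr_cos_le1.
have ig : (@lebesgue_measure R).-integrable (@angles R)
    (EFin \o (fun x => step_kernel dt l x * cos (n%:~R * x))).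
  apply: (@integrable_angles _ _ (4 * pi)^-1) => // x.
  exact: le_trans (gle x) (step_kernel_le _ _ dt0).
apply: le_trans (le_normr_Rintegral _ ig) _; first exact: measurable_angles.
apply: le_Rintegral => //.
- exact: measurable_angles.
- apply: (@integrable_angles _ _ (4 * pi)^-1) => [|x].
    exact: measurableT_comp (@normr_measurable R setT) mg.
  by rewrite normr_id; apply: le_trans (gle x) (step_kernel_le _ _ dt0).
- exact: integrable_step_kernel.
Qed.

(** The diagonal term is isolated and moduli are taken, which leaves the real inequality that
    [discrete_volterra_energy] takes as input. *)
Lemma fourier_mode_volterra (R : realType) (N : nat) (dt : R)
    (f sigma : 'I_N.+1 -> R * R -> R[i]) (n : int) (j : 'I_N.+1)
    (s := fun k => ComplexField.Normc.normc (fourier_mode sigma n k 0)) :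
  0 < dt -> forward_euler dt f sigma ->
  2^-1 * s j <= ComplexField.Normc.normc (fourier_mode f n j 0) +
    \sum_(k < N.+1 | (k < j)%N)
      \int[lebesgue_measure]_(x in @angles R) step_kernel dt (j - k.+1) x * s k.
Proof.
move=> dt0 euler; have := fourier_mode_euler n j dt0 euler.
set V := \sum_(k < N.+1 | _) _; set g := fourier_mode f n j 0 => E.
have E' : (- 2^-1)%:C * fourier_mode sigma n j 0 = g + V by rewrite E subrK.
have -> : 2^-1 * s j = ComplexField.Normc.normc (g + V).
  by rewrite -E' ComplexField.Normc.normcM normc_realE normrN gtr0_norm ?invr_gt0.
apply: le_trans (normcD_le _ _) _; rewrite lerD2l.
apply: le_trans (normc_sum_le _ _ _) _; apply: ler_sum => k _.
rewrite ComplexField.Normc.normcM normc_realE ler_wpM2r ?normc_ge0//.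
exact: step_multiplier_le.
Qed.

Theorem theorem4 (R : realType) (T : R) (hT : 1 <= T)
    (N : nat) (hN : (1 <= N)%N) (dt : R) (hdt : 0 < dt) (hNdt : N%:R * dt <= T)
    (f sigma : 'I_N.+1 -> R * R -> R[i]) (hscheme : forward_euler dt f sigma)
    (n : int) :
  l2norm (fourier_mode sigma n) <= 10 * T * l2norm (fourier_mode f n).
Proof.
have T0 : 0 < T by lra.
have d0 : 0 <= (8 * T)^-1 by rewrite invr_ge0 mulr_ge0// ltW.
have m0 l : 0 <= \int[lebesgue_measure]_(x in @angles R) step_kernel dt l x.
  by apply: Rintegral_ge0 => x _; exact: step_kernel_ge0.
have := @discrete_volterra_energy R N (8 * T)^-1
  (fun l => \int[lebesgue_measure]_(x in @angles R) step_kernel dt l x)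
  (fun j => ComplexField.Normc.normc (fourier_mode sigma n j 0))
  (fun j => ComplexField.Normc.normc (fourier_mode f n j 0)) d0
  m0
  (sum_step_mass hT hdt hN hNdt) (fun j => normc_ge0 _)
  (fun j => fourier_mode_volterra n j hdt hscheme).
rewrite /l2norm; set S := \sum_(j < _) _; set F := \sum_(j < _) _ => SF.
have F0 : 0 <= F by apply: sumr_ge0 => j _; exact: sqr_ge0.
rewrite -[10 * T]ger0_norm; last by rewrite mulr_ge0// ltW.
rewrite -sqrtr_sqr -sqrtrM ?sqr_ge0//; apply: ler_wsqrtr.
move: SF; rewrite exprVn mulrC ler_pdivrMr; last by rewrite exprn_gt0// mulr_gt0.
by move=> /le_trans; apply; rewrite mulrC; apply: ler_wpM2r => //; nra.
Qed.
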